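(* Let $R$ be a rectangle. There is no perfect Mondrian $5$-partition $\mathcal{P}=\{R_1,\dots,R_5\}$ of $R$. Moreover, there is a unique (up to symmetry of $R$) admissible $5$-partition of $R$ that is perfect, in the sense that all five of its rectangles have area $\frac15\,\mathrm{area}(R)$.
   Context: All rectangles have real side lengths. Two rectangles are congruent, written $R_1\cong R_2$, if the lengths of their sides (not necessarily in the same order) are equal. A $k$-partition ($k\ge 2$) of a rectangle $R$ is a tiling of $R$ by $k$ rectangles $R_1,\dots,R_k$. A partition $\{R_1,\dots,R_k\}$ of $R$ is a Mondrian partition if $R_i\not\cong R_j$ for all $i\ne j$. A Mondrian partition is perfect if $\mathrm{area}(R_i)=\frac1k\,\mathrm{area}(R)$ for every $i$. A partition of $R$ is admissible if no pair of its rectangles have a common side (i.e., no full side of one rectangle coincides with a full side of another). ''Up to symmetry'' means that partitions obtained from each other by a symmetry (such as a reflection) of $R$ are identified. *)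

(* Defs.v *)
From HB Require Import structures.
From mathcomp Require Import all_boot all_order all_algebra.
From mathcomp Require Import classical_sets reals.
Set Implicit Arguments.
Unset Strict Implicit.
Unset Printing Implicit Defensive.
Import Order.TTheory GRing.Theory Num.Theory.
Local Open Scope classical_set_scope.
Local Open Scope ring_scope.

(* A rectangle in the Euclidean plane, in arbitrary position and orientation:
   the rectangle with vertex [rorig] whose sides issuing from it are
   [width] times the unit vector u = (rcos, rsin) and
   [height] times the vector (- rsin, rcos).
   The same set of points has four such descriptions (one for each choice of
   the vertex); partitions are therefore compared through sets of points. *)
Record rect (R : realType) := Rect {
  rorig : R * R;
  rcos : R;
  rsin : R;
  width : R;
  height : R;
  rdir_unit : rcos ^+ 2 + rsin ^+ 2 = 1;
  width_gt0 : 0 < width;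
  height_gt0 : 0 < height }.

(* Coordinates of p in the orthonormal frame of r. *)
Definition xcoord (R : realType) (r : rect R) (p : R * R) : R :=
  rcos r * (p.1 - (rorig r).1) + rsin r * (p.2 - (rorig r).2).
Definition ycoord (R : realType) (r : rect R) (p : R * R) : R :=
  - rsin r * (p.1 - (rorig r).1) + rcos r * (p.2 - (rorig r).2).

Definition points (R : realType) (r : rect R) : set (R * R) :=
  [set p | 0 <= xcoord r p <= width r /\ 0 <= ycoord r p <= height r].

Definition interior_points (R : realType) (r : rect R) : set (R * R) :=
  [set p | 0 < xcoord r p < width r /\ 0 < ycoord r p < height r].

Definition area (R : realType) (r : rect R) : R := width r * height r.

Definition is_side (R : realType) (r : rect R) (A : set (R * R)) : Prop :=
  [\/ A = points r `&` [set p | xcoord r p = 0],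
      A = points r `&` [set p | xcoord r p = width r],
      A = points r `&` [set p | ycoord r p = 0] |
      A = points r `&` [set p | ycoord r p = height r]].

Definition congruent (R : realType) (r s : rect R) : Prop :=
  (width r = width s /\ height r = height s) \/
  (width r = height s /\ height r = width s).

Definition common_side (R : realType) (r s : rect R) : Prop :=
  exists A : set (R * R), is_side r A /\ is_side s A.

Definition is_partition (R : realType) (k : nat) (r : rect R)
    (P : 'I_k -> rect R) : Prop :=
  \bigcup_i points (P i) = points r /\
  forall i j : 'I_k, i != j ->
    interior_points (P i) `&` interior_points (P j) = set0.

Definition mondrian (R : realType) (k : nat) (P : 'I_k -> rect R) : Prop :=
  forall i j : 'I_k, i != j -> ~ congruent (P i) (P j).

Definition perfect (R : realType) (k : nat) (r : rect R)
    (P : 'I_k -> rect R) : Prop :=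
  forall i : 'I_k, area (P i) = k%:R^-1 * area r.

Definition admissible (R : realType) (k : nat) (P : 'I_k -> rect R) : Prop :=
  forall i j : 'I_k, i != j -> ~ common_side (P i) (P j).

(* Euclidean distance; the library norm on R * R is the sup norm. *)
Definition edist (R : realType) (p q : R * R) : R :=
  Num.sqrt ((p.1 - q.1) ^+ 2 + (p.2 - q.2) ^+ 2).

Definition is_symmetry (R : realType) (r : rect R) (f : R * R -> R * R) : Prop :=
  (forall p q : R * R, edist (f p) (f q) = edist p q) /\
  f @` points r = points r.

(* The unordered collection of the tiles of P, as sets of points. *)
Definition tiles (R : realType) (k : nat) (P : 'I_k -> rect R) :
    set (set (R * R)) :=
  [set points (P i) | i in [set: 'I_k]].

Definition same_up_to_symmetry (R : realType) (k : nat) (r : rect R)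
    (P Q : 'I_k -> rect R) : Prop :=
  exists f : R * R -> R * R, is_symmetry r f /\
    [set f @` A | A in tiles P] = tiles Q.

(* Main.v *)
Require Import Defs.
From mathcomp Require Import all_boot all_order all_algebra.
From mathcomp Require Import boolp.
From mathcomp Require Import classical_sets reals.
From mathcomp Require Import lra ring zify.
Set Implicit Arguments.
Unset Strict Implicit.
Unset Printing Implicit Defensive.
Import Order.TTheory GRing.Theory Num.Theory.
Local Open Scope ring_scope.

(** The tiles may a priori be tilted, so the first step is to see that they
are not. In the frame of the big rectangle, describe each tile by its lowest
vertex v and the two sides issuing from it, of directions (c, s) and (- s, c)
with c > 0 and s >= 0; the tile is tilted when s > 0. If some tile is tilted,
choose one whose lowest vertex v is as low as possible. To the right of
its first side there are points of the big rectangle arbitrarily close to v,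
hence a second tile that contains v and points slightly up and to the right
of v. If that tile is upright it fills the first quadrant near v; if it is
tilted then v is its lowest vertex too, and it contains the points slightly
above v. Both are impossible, as the tile first chosen has interior points
there ([tiles_aligned]). The tiling thus becomes a tiling of a box by five
axis-parallel boxes ([partition_boxes]).

Say that two boxes are adjacent when a full side of one is a full side of the
other. A tile containing two corners of the box spans one of its sides, and
can be removed; by induction any tiling with two, three or four tiles has two
adjacent tiles, the base of the argument being four tiles occupying one corner
each ([tiling_adjacent]). So in a tiling by five boxes without adjacent tiles,
the corners belong to four distinct tiles. The fifth tile cannot touch the
boundary ([layout_bottom], by symmetry [config_inner]), and the tiles must
form a pinwheel, of one of two chiralities ([config_pinwheel]).

If all areas are one fifth, and a is the width of the lower left tile in
proportion to the box, elimination gives a (1 - a) = 1/5; the chirality selects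
the smaller root, and all the coordinates are determined ([pinwheel_perfect]).
The two chiralities are exchanged by a reflection, which gives uniqueness.
Finally, two adjacent tiles of equal areas are congruent, so a perfect Mondrian
partition would be such a pinwheel; but opposite corner tiles of a perfect
pinwheel are congruent. *)

(** * Tilings of a box by boxes *)

Section Boxes.
Variable R : realFieldType.

(** An axis-parallel rectangle, possibly degenerate or empty: no order is
imposed on the bounds. *)
Record box := Box { xlo : R; xhi : R; ylo : R; yhi : R }.

(** Reflection in the vertical axis, and in the diagonal. Together they generate
the symmetries used to reduce a statement about the four sides or corners to
one of them. *)
Definition flipx (X : box) := Box (- xhi X) (- xlo X) (ylo X) (yhi X).
Definition swap (X : box) := Box (ylo X) (yhi X) (xlo X) (xhi X).

Definition solid (X : box) := xlo X < xhi X /\ ylo X < yhi X.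
Definition inside (X Y : box) :=
  (xlo Y <= xlo X /\ xhi X <= xhi Y) /\ (ylo Y <= ylo X /\ yhi X <= yhi Y).
(** The interiors of two nonempty boxes are disjoint. *)
Definition apart (X Y : box) :=
  (xhi X <= xlo Y \/ xhi Y <= xlo X) \/ (yhi X <= ylo Y \/ yhi Y <= ylo X).
(** A full side of one box is a full side of the other, the two boxes lying on
opposite sides of it. *)
Definition adjacent (X Y : box) :=
  ((ylo X = ylo Y /\ yhi X = yhi Y) /\ (xhi X = xlo Y \/ xhi Y = xlo X)) \/
  ((xlo X = xlo Y /\ xhi X = xhi Y) /\ (yhi X = ylo Y \/ yhi Y = ylo X)).
(** For a tile [Y] inside [X], [Y] contains two neighbouring corners of [X],
hence a full side of it. *)
Definition spans (Y X : box) :=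
  ((xlo Y = xlo X /\ xhi Y = xhi X) /\ (ylo Y = ylo X \/ yhi Y = yhi X)) \/
  ((ylo Y = ylo X /\ yhi Y = yhi X) /\ (xlo Y = xlo X \/ xhi Y = xhi X)).

Section Tiling.
Variable I : finType.

(** The boxes [T i], for [i] in [S], tile [X]. The covering condition is required
only for interior points of [X], which makes it easy to transfer; the stronger
forms below follow. *)
Record tiling (S : {set I}) (X : box) (T : I -> box) : Prop := Tiling {
  tile_solid : forall i, i \in S -> solid (T i);
  tile_inside : forall i, i \in S -> inside (T i) X;
  tile_apart : forall i j, i \in S -> j \in S -> i != j -> apart (T i) (T j);
  tile_cover : forall x y, xlo X < x < xhi X -> ylo X < y < yhi X ->
    exists2 i, i \in S & xlo (T i) <= x <= xhi (T i) /\
                         ylo (T i) <= y <= yhi (T i) }.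

Lemma tiling_flipx S X T : tiling S X T -> tiling S (flipx X) (flipx \o T).
Proof.
case=> h1 h2 h3 h4; split => /=.
- by move=> i /h1; rewrite /solid /=; lra.
- by move=> i /h2; rewrite /inside /=; lra.
- by move=> i j iS jS /(h3 _ _ iS jS); rewrite /apart /=; lra.
- move=> x y hx hy; have [i iS hi] := h4 (- x) y ltac:(lra) hy.
  by exists i => //; lra.
Qed.

Lemma tiling_swap S X T : tiling S X T -> tiling S (swap X) (swap \o T).
Proof.
case=> h1 h2 h3 h4; split => /=.
- by move=> i /h1; rewrite /solid /=; lra.
- by move=> i /h2; rewrite /inside /=; lra.
- by move=> i j iS jS /(h3 _ _ iS jS); rewrite /apart /=; lra.
- move=> x y hx hy; have [i iS hi] := h4 y x hy hx.
  by exists i => //; lra.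
Qed.

Lemma seq_gap (s : seq R) (x : R) :
  exists2 x', x < x' & forall c, c \in s -> c <= x \/ x' < c.
Proof.
elim: s => [|c s [x' xx' IH]]; first by exists (x + 1) => //; lra.
have [cx|xc] := lerP c x.
  by exists x' => // d; rewrite inE => /predU1P[->|/IH//]; left.
exists (Num.min x' ((x + c) / 2%:R)); first by rewrite lt_min; apply/andP; split; lra.
move=> d; rewrite inE => /predU1P[->|/IH[|x'd]]; [right|by left|right];
  rewrite gt_min; apply/orP; [right; lra|by left].
Qed.

(** Half-open tiles cover the half-open box: at each point, some tile contains
the north-east germ. The three next lemmas are the other orientations. *)
Lemma cover_NE S X T x y : tiling S X T ->
  xlo X <= x < xhi X -> ylo X <= y < yhi X ->
  exists2 i, i \in S & (xlo (T i) <= x < xhi (T i)) /\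
                       (ylo (T i) <= y < yhi (T i)).
Proof.
move=> tl hx hy.
(* Move the point slightly to the north-east, without meeting the bounds of
   the tiles. *)
have [x' xx' hx'] := seq_gap (xhi X :: [seq xlo (T i) | i : I]) x.
have [y' yy' hy'] := seq_gap (yhi X :: [seq ylo (T i) | i : I]) y.
have Hx := hx' _ (mem_head _ _); have Hy := hy' _ (mem_head _ _).
have [i iS hi] := tile_cover tl (x := x') (y := y') ltac:(lra) ltac:(lra).
exists i => //.
have {}hx' : xlo (T i) <= x \/ x' < xlo (T i).
  by apply: hx'; rewrite inE; apply/orP; right; exact: map_f (mem_enum _ _).
have {}hy' : ylo (T i) <= y \/ y' < ylo (T i).
  by apply: hy'; rewrite inE; apply/orP; right; exact: map_f (mem_enum _ _).
lra.
Qed.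

Lemma cover_NW S X T x y : tiling S X T ->
  xlo X < x <= xhi X -> ylo X <= y < yhi X ->
  exists2 i, i \in S & (xlo (T i) < x <= xhi (T i)) /\
                       (ylo (T i) <= y < yhi (T i)).
Proof.
move=> /tiling_flipx tl hx hy.
have [i iS /= hi] := cover_NE (x := - x) (y := y) tl ltac:(simpl; lra) ltac:(simpl; lra).
by exists i => //; lra.
Qed.

Lemma cover_SE S X T x y : tiling S X T ->
  xlo X <= x < xhi X -> ylo X < y <= yhi X ->
  exists2 i, i \in S & (xlo (T i) <= x < xhi (T i)) /\
                       (ylo (T i) < y <= yhi (T i)).
Proof.
move=> /tiling_swap tl hx hy.
have [i iS /= hi] := cover_NW (x := y) (y := x) tl ltac:(simpl; lra) ltac:(simpl; lra).
by exists i => //; lra.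
Qed.

Lemma cover_SW S X T x y : tiling S X T ->
  xlo X < x <= xhi X -> ylo X < y <= yhi X ->
  exists2 i, i \in S & (xlo (T i) < x <= xhi (T i)) /\
                       (ylo (T i) < y <= yhi (T i)).
Proof.
move=> /tiling_flipx tl hx hy.
have [i iS /= hi] := cover_SE (x := - x) (y := y) tl ltac:(simpl; lra) ltac:(simpl; lra).
by exists i => //; lra.
Qed.

(** Removing a tile that spans a side leaves a tiling of a smaller box, which is
adjacent to the tile removed. *)
Lemma tiling_remove S X T i : tiling S X T -> i \in S -> spans (T i) X ->
  exists2 X', tiling (S :\ i) X' T & adjacent (T i) X'.
Proof.
move=> tl iS sp.
suff [X' [adj ins out]] : exists X', [/\ adjacent (T i) X',
    (forall Y, solid Y -> inside Y X -> apart Y (T i) -> inside Y X') &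
    (forall x y, xlo X' < x < xhi X' -> ylo X' < y < yhi X' ->
       (xlo X < x < xhi X /\ ylo X < y < yhi X) /\
       ~ (xlo (T i) <= x <= xhi (T i) /\ ylo (T i) <= y <= yhi (T i)))].
  exists X' => //; split.
  - by move=> j /setD1P[_ /(tile_solid tl)].
  - move=> j /setD1P[ji jS]; apply: ins; first exact: tile_solid tl _ jS.
      exact: tile_inside tl _ jS.
    exact: tile_apart tl _ _ jS iS ji.
  - by move=> j k /setD1P[_ jS] /setD1P[_ kS]; exact: tile_apart tl _ _ jS kS.
  - move=> x y hx hy; have [[hx' hy'] nin] := out x y hx hy.
    have [j jS hj] := tile_cover tl hx' hy'.
    exists j => //; rewrite in_setD1 jS andbT.
    by apply: contra_notN nin => /eqP <-.
have := tile_solid tl iS; have := tile_inside tl iS.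
rewrite /adjacent /spans /solid /inside /apart in sp * => insi soli.
case: sp => -[e1 [e2|e2]].
- exists (Box (xlo X) (xhi X) (yhi (T i)) (yhi X)); split => /=; try lra.
  + by move=> Y; lra.
  + by move=> x y; lra.
- exists (Box (xlo X) (xhi X) (ylo X) (ylo (T i))); split => /=; try lra.
  + by move=> Y; lra.
  + by move=> x y; lra.
- exists (Box (xhi (T i)) (xhi X) (ylo X) (yhi X)); split => /=; try lra.
  + by move=> Y; lra.
  + by move=> x y; lra.
- exists (Box (xlo X) (xlo (T i)) (ylo X) (yhi X)); split => /=; try lra.
  + by move=> Y; lra.
  + by move=> x y; lra.
Qed.
End Tiling.
End Boxes.

(** * Corner tiles *)

Section Corners.
Variables (R : realFieldType) (I : finType).
Implicit Types (S : {set I}) (X : box R) (T : I -> box R).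

(** The box contains the germ at [(x, y)] of the quadrant named. *)
Definition atNE (Y : box R) x y :=
  xlo Y <= x < xhi Y /\ ylo Y <= y < yhi Y.
Definition atNW (Y : box R) x y :=
  xlo Y < x <= xhi Y /\ ylo Y <= y < yhi Y.
Definition atSE (Y : box R) x y :=
  xlo Y <= x < xhi Y /\ ylo Y < y <= yhi Y.
Definition atSW (Y : box R) x y :=
  xlo Y < x <= xhi Y /\ ylo Y < y <= yhi Y.

Lemma tiling_solid S X T i : tiling S X T -> i \in S -> solid X.
Proof.
move=> tl iS; have := tile_solid tl iS; have := tile_inside tl iS.
by rewrite /solid /inside; lra.
Qed.

Lemma tiling_set1 X T j : tiling [set j] X T -> T j = X.
Proof.
move=> tl; have jS : j \in [set j] by rewrite set11.
have [sX sY] := tiling_solid tl jS.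
have [sT [iX iY]] := (tile_solid tl jS, tile_inside tl jS).
have [_ /set1P-> h1] := cover_NE tl (x := xlo X) (y := ylo X) ltac:(lra) ltac:(lra).
have [_ /set1P-> h2] := cover_SW tl (x := xhi X) (y := yhi X) ltac:(lra) ltac:(lra).
case: (T j) X sX sY sT iX iY h1 h2 {tl jS} => a b c d [a' b' c' d'] /= *.
by congr Box; lra.
Qed.

(** The boxes have the corners of [X] in counterclockwise order, from the lower
left one. *)
Definition corners X a b c d :=
  [/\ xlo a = xlo X /\ ylo a = ylo X, xhi b = xhi X /\ ylo b = ylo X,
      xhi c = xhi X /\ yhi c = yhi X & xlo d = xlo X /\ yhi d = yhi X].

(** Either some tile contains two corners of [X], or the corners belong to four
distinct tiles. *)
Lemma tiling_corners S X T i0 : tiling S X T -> i0 \in S ->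
  (exists2 i, i \in S & spans (T i) X) \/
  exists A B C D, [/\ uniq [:: A; B; C; D], all [in S] [:: A; B; C; D] &
    corners X (T A) (T B) (T C) (T D)].
Proof.
move=> tl i0S; have [sX sY] := tiling_solid tl i0S.
have [A AS hA] := cover_NE tl (x := xlo X) (y := ylo X) ltac:(lra) ltac:(lra).
have [B BS hB] := cover_NW tl (x := xhi X) (y := ylo X) ltac:(lra) ltac:(lra).
have [C CS hC] := cover_SW tl (x := xhi X) (y := yhi X) ltac:(lra) ltac:(lra).
have [D DS hD] := cover_SE tl (x := xlo X) (y := yhi X) ltac:(lra) ltac:(lra).
have iA := tile_inside tl AS; have iB := tile_inside tl BS.
have iC := tile_inside tl CS; have iD := tile_inside tl DS.
rewrite /inside in iA iB iC iD *.
have [eAB|nAB] := eqVneq A B.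
  by left; exists A => //; subst B; rewrite /spans; lra.
have [eAC|nAC] := eqVneq A C.
  by left; exists A => //; subst C; rewrite /spans; lra.
have [eAD|nAD] := eqVneq A D.
  by left; exists A => //; subst D; rewrite /spans; lra.
have [eBC|nBC] := eqVneq B C.
  by left; exists B => //; subst C; rewrite /spans; lra.
have [eBD|nBD] := eqVneq B D.
  by left; exists B => //; subst D; rewrite /spans; lra.
have [eCD|nCD] := eqVneq C D.
  by left; exists C => //; subst D; rewrite /spans; lra.
right; exists A, B, C, D; split; last first.
  by move: hA hB hC hD iA iB iC iD; clear; rewrite /corners => *; split; lra.
  by rewrite /= AS BS CS DS.
by rewrite /= !inE !negb_or nAB nAC nAD nBC nBD nCD.
Qed.

Definition apart4 (a b c d : box R) :=
  [/\ apart a b, apart a c, apart a d & [/\ apart b c, apart b d & apart c d]].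

(** When the tiles are exactly four, one at each corner, consecutive ones meet
along each side of [X]. If [a] and [d] have different widths, then [a] and [b]
have equal heights, for otherwise a hole remains in the middle. *)
Lemma four_corners X a b c d :
  [/\ solid a, solid b, solid c & solid d] ->
  [/\ inside a X, inside b X, inside c X & inside d X] ->
  apart4 a b c d -> corners X a b c d ->
  (forall x y, xlo X <= x < xhi X -> ylo X <= y < yhi X ->
     [\/ atNE a x y, atNE b x y, atNE c x y | atNE d x y]) ->
  (forall x y, xlo X < x <= xhi X -> ylo X <= y < yhi X ->
     [\/ atNW a x y, atNW b x y, atNW c x y | atNW d x y]) ->
  (forall x y, xlo X <= x < xhi X -> ylo X < y <= yhi X ->
     [\/ atSE a x y, atSE b x y, atSE c x y | atSE d x y]) ->
  adjacent a b \/ adjacent a d.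
Proof.
case=> sa sb sc sd [ia ib ic id] [ab ac ad [bc bd cd]] [ka kb kc kd] hNE hNW hSE.
rewrite /solid /inside in sa sb sc sd ia ib ic id.
have ltab : xhi a <= xlo b by move: ab; rewrite /apart; lra.
have ltad : yhi a <= ylo d by move: ad; rewrite /apart; lra.
have ltbc : yhi b <= ylo c by move: bc; rewrite /apart; lra.
have ltdc : xhi d <= xlo c by move: cd; rewrite /apart; lra.
have eab : xlo b = xhi a.
  case: (hNE (xhi a) (ylo X)); rewrite /atNE; lra.
have ead : ylo d = yhi a.
  case: (hNE (xlo X) (yhi a)); rewrite /atNE; lra.
have ebc : ylo c = yhi b.
  case: (hNW (xhi X) (yhi b)); rewrite /atNW; lra.
have edc : xlo c = xhi d.
  case: (hSE (xhi d) (yhi X)); rewrite /atSE; lra.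
(* The sample points below are the lower left corner of the hole. *)
have [lt|lt|eq] := ltgtP (xhi a) (xhi d); last by
  (right; right; split; [split; lra|left; lra]).
- left; suff : yhi b = yhi a by rewrite /adjacent; lra.
  have : yhi b <= yhi a by move: bd; rewrite /apart; lra.
  by case: (hNE (xhi a) (yhi b)); rewrite /atNE; lra.
- left; suff : yhi b = yhi a by rewrite /adjacent; lra.
  have : yhi a <= yhi b by move: ac; rewrite /apart; lra.
  by case: (hNE (xhi d) (yhi a)); rewrite /atNE; lra.
Qed.

End Corners.

(** * Tilings with at most four tiles *)

Section Few.
Variables (R : realFieldType) (I : finType) (T : I -> box R).
Implicit Types (S : {set I}) (X : box R).

Lemma tiling_adjacent S X : tiling S X T -> (1 < #|S| <= 4)%N ->
  exists i j, [/\ i \in S, j \in S, i != j & adjacent (T i) (T j)].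
Proof.
have [n] := ubnP #|S|; elim: n S X => // n IH S X; rewrite ltnS => Sn tl /andP[S1 S4].
have [i0 i0S] : exists i, i \in S by apply/card_gt0P; exact: ltnW.
have [[i iS sp]|] := tiling_corners tl i0S.
  have [X' tl' adj] := tiling_remove tl iS sp.
  have cS' := cardsD1 i S; rewrite iS add1n in cS'.
  have [S'1|S'1] := leqP #|S :\ i| 1.
    have /cards1P[j Sj] : #|S :\ i| == 1%N by rewrite eqn_leq S'1 -ltnS -cS'.
    have : j \in S :\ i by rewrite Sj set11.
    rewrite Sj in tl'; rewrite in_setD1 => /andP[ji jS].
    by exists i, j; rewrite (tiling_set1 tl') eq_sym.
  have [||j [k [/setD1P[_ jS] /setD1P[_ kS] jk adjk]]] := IH _ _ _ tl'.
  - by rewrite -cS'.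
  - by rewrite S'1 /= -ltnS -cS' (leq_trans S4).
  - by exists j, k.
move=> [A [B [C [D [uq /allP sub cn]]]]].
have [AS BS CS DS] : [/\ A \in S, B \in S, C \in S & D \in S].
  by split; apply: sub; rewrite !inE eqxx ?orbT.
have eS : [:: A; B; C; D] =i enum S.
  have sub' : {subset [:: A; B; C; D] <= enum S}.
    by move=> k /sub; rewrite mem_enum.
  by case: (uniq_min_size uq sub') => //; rewrite -cardE.
have inS k : k \in S -> [\/ k = A, k = B, k = C | k = D].
  rewrite -mem_enum -eS !inE => /or4P[] /eqP->;
    by [apply: Or41 | apply: Or42 | apply: Or43 | apply: Or44].
have sd := tile_solid tl; have ins := tile_inside tl; have ap := tile_apart tl.
move: (uq); rewrite /= !inE !negb_or => /and4P[/and3P[nAB nAC nAD] /andP[nBC nBD] nCD _].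
have [] := @four_corners _ X (T A) (T B) (T C) (T D).
- by split; apply: sd.
- by split; apply: ins.
- by split; [apply: ap..|split; apply: ap].
- by [].
- move=> x y hx hy; have [k /inS[]-> ?] := cover_NE tl hx hy;
    by [apply: Or41 | apply: Or42 | apply: Or43 | apply: Or44].
- move=> x y hx hy; have [k /inS[]-> ?] := cover_NW tl hx hy;
    by [apply: Or41 | apply: Or42 | apply: Or43 | apply: Or44].
- move=> x y hx hy; have [k /inS[]-> ?] := cover_SE tl hx hy;
    by [apply: Or41 | apply: Or42 | apply: Or43 | apply: Or44].
- by exists A, B.
- by exists A, D.
Qed.
End Few.

(** * Tilings with five tiles and no adjacent pair *)

Section Five.
Variables (R : realFieldType) (I : finType).
Implicit Types (S : {set I}) (X : box R) (T : I -> box R).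

(** A tiling by five pairwise nonadjacent tiles, of which [A], [B], [C], [D] are
at the corners, in counterclockwise order from the lower left one. *)
Record config S X T A B C D E : Prop := Config {
  cfg_tiling : tiling S X T;
  cfg_nonadj : forall i j, i \in S -> j \in S -> i != j -> ~ adjacent (T i) (T j);
  cfg_uniq : uniq [:: A; B; C; D; E];
  cfg_set : S =i [:: A; B; C; D; E];
  cfg_corners : corners X (T A) (T B) (T C) (T D) }.

Lemma tiling_config S X T : tiling S X T -> #|S| = 5 ->
  (forall i j, i \in S -> j \in S -> i != j -> ~ adjacent (T i) (T j)) ->
  exists A B C D E, config S X T A B C D E.
Proof.
move=> tl S5 nadj.
have [i0 i0S] : exists i, i \in S by apply/card_gt0P; rewrite S5.
have [[i iS sp]|] := tiling_corners tl i0S.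
  have [X' tl' _] := tiling_remove tl iS sp.
  have cS' := cardsD1 i S; rewrite iS add1n S5 in cS'; case: cS' => cS'.
  have [|j [k [/setD1P[_ jS] /setD1P[_ kS] jk adjk]]] := tiling_adjacent tl'.
    by rewrite -cS'.
  by case: (nadj _ _ jS kS jk adjk).
move=> [A [B [C [D [uq /allP sub cn]]]]].
have [E ES nE] : exists2 E, E \in S & E \notin [:: A; B; C; D].
  apply/subsetPn; apply/negP => /subset_leq_card.
  by rewrite S5 (card_uniqP uq).
exists A, B, C, D, E; split => //.
- by rewrite -[[:: A; B; C; D; E]]/(rcons [:: A; B; C; D] E) rcons_uniq nE.
- have sub' : {subset [:: A; B; C; D; E] <= enum S}.
    move=> k; rewrite -[[:: A; B; C; D; E]]/(rcons [:: A; B; C; D] E).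
    by rewrite mem_rcons in_cons mem_enum => /predU1P[->|/sub].
  have uq' : uniq [:: A; B; C; D; E].
    by rewrite -[[:: A; B; C; D; E]]/(rcons [:: A; B; C; D] E) rcons_uniq nE.
  move=> k; rewrite -mem_enum.
  by have [|_ ->] := uniq_min_size uq' sub'; rewrite // -cardE S5.
Qed.

Lemma adjacent_flipx (X Y : box R) : adjacent (flipx X) (flipx Y) -> adjacent X Y.
Proof. by rewrite /adjacent /=; lra. Qed.

Lemma adjacent_swap (X Y : box R) : adjacent (swap X) (swap Y) -> adjacent X Y.
Proof. by rewrite /adjacent /=; lra. Qed.

Lemma config_flipx S X T A B C D E : config S X T A B C D E ->
  config S (flipx X) (@flipx R \o T) B A D C E.
Proof.
case=> tl nadj uq eS cn; split.
- exact: tiling_flipx.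
- by move=> i j iS jS ij /adjacent_flipx; exact: nadj.
- by rewrite (perm_uniq (_ : perm_eq _ [:: A; B; C; D; E])) //;
    apply/permP => p /=; lia.
- by move=> k; rewrite eS !inE; do !case: (_ == _).
- by case: cn => *; split => /=; lra.
Qed.

Lemma config_swap S X T A B C D E : config S X T A B C D E ->
  config S (swap X) (@swap R \o T) A D C B E.
Proof.
case=> tl nadj uq eS cn; split.
- exact: tiling_swap.
- by move=> i j iS jS ij /adjacent_swap; exact: nadj.
- by rewrite (perm_uniq (_ : perm_eq _ [:: A; B; C; D; E])) //;
    apply/permP => p /=; lia.
- by move=> k; rewrite eS !inE; do !case: (_ == _).
- by case: cn => *; split => /=; lra.
Qed.
End Five.

Section Pinwheel.
Variables (R : realFieldType) (I : finType).
Implicit Types (S : {set I}) (X : box R) (T : I -> box R).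

Lemma config_cases S X T A B C D E (P : box R -> Prop) : config S X T A B C D E ->
  (exists2 i, i \in S & P (T i)) ->
  P (T A) \/ P (T B) \/ P (T C) \/ P (T D) \/ P (T E).
Proof.
move=> cf [i]; rewrite (cfg_set cf) !inE.
by case/or4P => [/eqP-> |/eqP-> |/eqP-> |/predU1P[-> | /eqP->]]; tauto.
Qed.

(** The consequences of [config] for the five boxes themselves, in the form
where linear arithmetic can exploit them. *)
Record layout X a b c d e : Prop := Layout {
  lay_solid : [/\ solid a, solid b, solid c, solid d & solid e];
  lay_inside : [/\ inside a X, inside b X, inside c X, inside d X & inside e X];
  lay_corners : corners X a b c d;
  lay_sides : [/\ xhi a <= xlo b, yhi a <= ylo d, yhi b <= ylo c & xhi d <= xlo c];
  lay_apart_e : [/\ apart a e, apart b e, apart c e & apart d e];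
  lay_apart : apart a c /\ apart b d;
  lay_nonadj : [/\ ~ adjacent a b, ~ adjacent a d, ~ adjacent a e & ~ adjacent b e];
  lay_NE : forall x y, xlo X <= x < xhi X -> ylo X <= y < yhi X ->
    atNE a x y \/ atNE b x y \/ atNE c x y \/ atNE d x y \/ atNE e x y;
  lay_NW : forall x y, xlo X < x <= xhi X -> ylo X <= y < yhi X ->
    atNW a x y \/ atNW b x y \/ atNW c x y \/ atNW d x y \/ atNW e x y;
  lay_SE : forall x y, xlo X <= x < xhi X -> ylo X < y <= yhi X ->
    atSE a x y \/ atSE b x y \/ atSE c x y \/ atSE d x y \/ atSE e x y;
  lay_SW : forall x y, xlo X < x <= xhi X -> ylo X < y <= yhi X ->
    atSW a x y \/ atSW b x y \/ atSW c x y \/ atSW d x y \/ atSW e x y }.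

Lemma config_layout S X T A B C D E : config S X T A B C D E ->
  layout X (T A) (T B) (T C) (T D) (T E).
Proof.
move=> cf; have [tl nadj uq eS cn] := cf.
have sd := tile_solid tl; have ins := tile_inside tl; have ap := tile_apart tl.
have [AS BS [CS DS ES]] : [/\ A \in S, B \in S & [/\ C \in S, D \in S & E \in S]].
  by rewrite !eS !inE !eqxx !orbT.
move: uq; rewrite /= !inE !negb_or => /and5P[/and4P[nAB nAC nAD nAE]
  /and3P[nBC nBD nBE] /andP[nCD nCE] nDE _].
have [ka kb kc kd] := cn.
have [sa sb sc sd'] : [/\ solid (T A), solid (T B), solid (T C) & solid (T D)].
  by split; apply: sd.
have [ia ib ic id] : [/\ inside (T A) X, inside (T B) X, inside (T C) X & inside (T D) X].
  by split; apply: ins.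
split => //.
- by split; apply: sd.
- by split; apply: ins.
- have := ap _ _ AS BS nAB; have := ap _ _ AS DS nAD.
  have := ap _ _ BS CS nBC; have := ap _ _ CS DS nCD.
  rewrite /apart /solid /inside in sa sb sc sd' ia ib ic id *.
  by move=> p4 p3 p2 p1; split; [clear p2 p3 p4; lra | clear p1 p3 p4; lra
    | clear p1 p2 p4; lra | clear p1 p2 p3; lra].
- by split; apply: ap.
- by split; apply: ap.
- by split; apply: nadj.
- move=> x y hx hy; exact: (config_cases (P := fun Y => atNE Y x y) cf (cover_NE tl hx hy)).
- move=> x y hx hy; exact: (config_cases (P := fun Y => atNW Y x y) cf (cover_NW tl hx hy)).
- move=> x y hx hy; exact: (config_cases (P := fun Y => atSE Y x y) cf (cover_SE tl hx hy)).
- move=> x y hx hy; exact: (config_cases (P := fun Y => atSW Y x y) cf (cover_SW tl hx hy)).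
Qed.

(** The fifth tile does not touch the lower side. Otherwise it stands between
[a] and [b]. If it reaches the top, then [a] and [d] have the same width; if
not, then [d] and [c] meet on the upper side. If they meet to the right of the
common border of [a] and [e], then [d] extends over [e], which must have the
height of [a]; if they meet to the left of it, then [c] extends over [e], which
must have the height of [b]; otherwise [a] and [d] have the same width. *)
Lemma layout_bottom X a b c d e : layout X a b c d e -> ylo e <> ylo X.
Proof.
case=> -[sa sb sc sd se] [ia ib ic id ie] [ka kb kc kd] [ab ad bc dc]
  [ae be ce de] [ac bd] [nab nad nae nbe] hNE hNW hSE hSW bot.
rewrite /solid /inside in sa sb sc sd se ia ib ic id ie.
have {ae} xae : xhi a <= xlo e by move: ae; rewrite /apart; lra.
have {be} xeb : xhi e <= xlo b by move: be; rewrite /apart; lra.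
have ea : xlo e = xhi a.
  by move: (hNE (xhi a) (ylo X) ltac:(lra) ltac:(lra)); rewrite /atNE; lra.
have eb : xlo b = xhi e.
  by move: (hNE (xhi e) (ylo X) ltac:(lra) ltac:(lra)); rewrite /atNE; lra.
have ed : ylo d = yhi a.
  by move: (hNE (xlo X) (yhi a) ltac:(lra) ltac:(lra)); rewrite /atNE; lra.
have ec : ylo c = yhi b.
  by move: (hNW (xhi X) (yhi b) ltac:(lra) ltac:(lra)); rewrite /atNW; lra.
have nda : xhi d <> xhi a.
  by move=> da; apply: nad; rewrite /adjacent; right; split; [split; lra|left; lra].
have [top|top] : yhi e = yhi X \/ yhi e < yhi X by lra.
  have xde : xhi d <= xlo e by move: de; rewrite /apart; lra.
  have xec : xhi e <= xlo c by move: ce; rewrite /apart; lra.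
  by move: (hNE (xhi d) (yhi a) ltac:(lra) ltac:(lra)); rewrite /atNE; lra.
have edc : xlo c = xhi d.
  by move: (hSE (xhi d) (yhi X) ltac:(lra) ltac:(lra)); rewrite /atSE; lra.
(* The tile [d], resp. [c], overhangs [e]; the sample point is the upper left,
   resp. right, corner of [e]. *)
have [lt|lt] : xhi a < xhi d \/ xhi d < xhi a by lra.
- have yed : yhi e <= ylo d by move: de; rewrite /apart; lra.
  apply: nae; left; split; [split; first lra|left; lra].
  by move: (hNE (xhi a) (yhi e) ltac:(lra) ltac:(lra)); rewrite /atNE; lra.
- have yec : yhi e <= ylo c by move: ce; rewrite /apart; lra.
  apply: nbe; left; split; [split; first lra|right; lra].
  by move: (hNW (xhi e) (yhi e) ltac:(lra) ltac:(lra)); rewrite /atNW; lra.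
Qed.

Lemma config_inner S X T A B C D E : config S X T A B C D E ->
  (xlo X < xlo (T E) /\ xhi (T E) < xhi X) /\ (ylo X < ylo (T E) /\ yhi (T E) < yhi X).
Proof.
move=> cf.
have ES : E \in S by rewrite (cfg_set cf) !inE eqxx !orbT.
have := tile_inside (cfg_tiling cf) ES.
have := layout_bottom (config_layout cf).
have := layout_bottom (config_layout (config_swap cf)).
have := layout_bottom (config_layout (config_swap (config_flipx cf))).
have := layout_bottom (config_layout (config_swap (config_flipx (config_swap cf)))).
rewrite /inside /=; lra.
Qed.

(** Tiles [a], [b], [c], [d] turn around the central tile [e], and
[d] lies above both [a] and [e]. The opposite chirality is obtained by [flipx]. *)
Record pinwheel X a b c d e : Prop := Pinwheel {
  pin_corners : corners X a b c d;
  pin_sides : [/\ xlo b = xhi a, ylo d = yhi a, ylo c = yhi b & xlo c = xhi d];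
  pin_center : [/\ xlo e = xhi a, xhi e = xhi d, ylo e = yhi b & yhi e = yhi a];
  pin_lt : xhi a < xhi d /\ yhi b < yhi a }.

Lemma layout_sides X a b c d e : layout X a b c d e ->
  (xlo X < xlo e /\ xhi e < xhi X) /\ (ylo X < ylo e /\ yhi e < yhi X) ->
  [/\ xlo b = xhi a, ylo d = yhi a, ylo c = yhi b & xlo c = xhi d].
Proof.
case=> -[sa sb sc sd se] [ia ib ic id ie] [ka kb kc kd] [ab ad bc dc]
  [ae be ce de] [ac bd] [nab nad nae nbe] hNE hNW hSE hSW inn.
rewrite /solid /inside in sa sb sc sd se ia ib ic id ie.
split.
- by move: (hNE (xhi a) (ylo X) ltac:(lra) ltac:(lra)); rewrite /atNE; lra.
- by move: (hNE (xlo X) (yhi a) ltac:(lra) ltac:(lra)); rewrite /atNE; lra.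
- by move: (hNW (xhi X) (yhi b) ltac:(lra) ltac:(lra)); rewrite /atNW; lra.
- by move: (hSE (xhi d) (yhi X) ltac:(lra) ltac:(lra)); rewrite /atSE; lra.
Qed.

(** The chirality is decided by which of [a] and [d] is wider. *)
Lemma layout_pinwheel X a b c d e : layout X a b c d e ->
  [/\ xlo b = xhi a, ylo d = yhi a, ylo c = yhi b & xlo c = xhi d] ->
  xhi a < xhi d -> pinwheel X a b c d e.
Proof.
case=> -[sa sb sc sd se] [ia ib ic id ie] k [_ _ _ _]
  [ae be ce de] [ac bd] [nab nad nae nbe] hNE hNW hSE hSW eqs lt.
have [[ka kb kc kd] [eb ed ec edc]] := (k, eqs).
rewrite /solid /inside in sa sb sc sd se ia ib ic id ie.
have leba : yhi b <= yhi a by move: bd; rewrite /apart; lra.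
have ltba : yhi b < yhi a.
  rewrite lt_neqAle leba andbT; apply: contra_notN nab => /eqP e0.
  by left; split; [split; lra|left; lra].
have eNE : atNE e (xhi a) (yhi b).
  by case: (hNE (xhi a) (yhi b) ltac:(lra) ltac:(lra)) => [|[|[|[]]]] //;
    rewrite /atNE; lra.
have eSW : atSW e (xhi d) (yhi a).
  by case: (hSW (xhi d) (yhi a) ltac:(lra) ltac:(lra)) => [|[|[|[]]]] //;
    rewrite /atSW; lra.
rewrite /atNE /atSW in eNE eSW.
split=> //; split.
- by move: ae; rewrite /apart; lra.
- by move: ce; rewrite /apart; lra.
- by move: be; rewrite /apart; lra.
- by move: de; rewrite /apart; lra.
Qed.

Lemma config_pinwheel S X T A B C D E : config S X T A B C D E ->
  pinwheel X (T A) (T B) (T C) (T D) (T E) \/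
  pinwheel (flipx X) (flipx (T B)) (flipx (T A)) (flipx (T D)) (flipx (T C))
    (flipx (T E)).
Proof.
move=> cf.
have lay := config_layout cf; have lay' := config_layout (config_flipx cf).
have sides := layout_sides lay (config_inner cf).
have sides' := layout_sides lay' (config_inner (config_flipx cf)).
have [lt|gt|eq] := ltgtP (xhi (T A)) (xhi (T D)).
- by left; exact: layout_pinwheel.
- by right; apply: layout_pinwheel => //=; case: sides; lra.
- have [_ nad _ _] := lay_nonadj lay.
  have [[ka _ _ kd] [_ eqd _ _]] := (lay_corners lay, sides).
  by case: nad; right; split; [split; lra|left; lra].
Qed.
End Pinwheel.

(** * Pinwheels with equal areas *)

Section Areas.

(** The corner tiles of a pinwheel in the unit square, all of area 1/5: their
areas are [a * b], [(1 - a) * c], [(1 - d) * (1 - c)] and [d * (1 - b)]. *)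
Lemma pinwheel_unit (R : realFieldType) (a b c d : R) :
  a * b = 5%:R^-1 -> (1 - a) * c = 5%:R^-1 ->
  (1 - d) * (1 - c) = 5%:R^-1 -> d * (1 - b) = 5%:R^-1 -> c < b ->
  [/\ a * (1 - a) = 5%:R^-1, b = 1 - a, c = a, d = 1 - a & a < 1 - a].
Proof.
move=> ab ac dc db cb.
have n5 : 5%:R^-1 != 0 :> R by lra.
have a0 : a != 0 by apply: contraNneq n5 => a0; rewrite -ab a0 mul0r.
have a1 : 1 - a != 0 by apply: contraNneq n5 => a1; rewrite -ac a1 mul0r.
have e1 : d * (a - 5%:R^-1) = 5%:R^-1 * a 
  by move: (congr1 ( *%R a) db) (congr1 ( *%R d) ab); lra.
have e2 : (1 - d) * (1 - a - 5%:R^-1) = 5%:R^-1 * (1 - a).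
  by move: (congr1 ( *%R (1 - a)) dc) (congr1 ( *%R (1 - d)) ac); lra.
have m : a * (1 - a) = 5%:R^-1.
  set s := 5%:R^-1 in e1 e2 *.
  have : (a - s) * (1 - a - s) = s * a * (1 - a - s) + s * (1 - a) * (a - s).
    by rewrite -e1 -e2; ring.
  rewrite /s; lra.
have eb : b = 1 - a by apply: (mulfI a0); rewrite ab.
have ec : c = a by apply: (mulfI a1); rewrite ac mulrC.
have ed : d = 1 - a.
  suff : 1 - d = a by lra.
  by apply: (mulIf a1); rewrite m -dc ec.
by split => //; lra.
Qed.

End Areas.

Section Ratio.
Variable R : rcfType.

(** The smaller root of [x * (1 - x) = 1/5], that is (5 - sqrt 5) / 10. *)
Definition ratio : R := (1 - Num.sqrt 5%:R^-1) / 2%:R.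

Lemma ratioP : ratio * (1 - ratio) = 5%:R^-1 /\ 0 < ratio < 1 - ratio.
Proof.
have e : Num.sqrt 5%:R^-1 ^+ 2 = 5%:R^-1 :> R by rewrite sqr_sqrtr //; lra.
have p : 0 < Num.sqrt 5%:R^-1 :> R by rewrite sqrtr_gt0; lra.
rewrite /ratio; move: (Num.sqrt _) e p => s e p; split; first by lra.
by nra.
Qed.

Lemma ratio_unique (a : R) : a * (1 - a) = 5%:R^-1 -> a < 1 - a -> a = ratio.
Proof.
move=> m lt; suff -> : ratio = (1 - `|1 - 2%:R * a|) / 2%:R.
  by rewrite ger0_norm; lra.
by rewrite -sqrtr_sqr /ratio; congr ((1 - Num.sqrt _) / _); lra.
Qed.

Definition bwidth (X : box R) := xhi X - xlo X.
Definition bheight (X : box R) := yhi X - ylo X.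

(** The part of [X] given by proportions of its width and height. *)
Definition subbox (X : box R) (x1 x2 y1 y2 : R) :=
  Box (xlo X + x1 * bwidth X) (xlo X + x2 * bwidth X)
      (ylo X + y1 * bheight X) (ylo X + y2 * bheight X).

Definition barea (X : box R) := bwidth X * bheight X.

Lemma pinwheel_perfect (X a b c d e : box R) : solid X -> pinwheel X a b c d e ->
  [/\ barea a = 5%:R^-1 * barea X, barea b = 5%:R^-1 * barea X,
      barea c = 5%:R^-1 * barea X & barea d = 5%:R^-1 * barea X] ->
  [/\ a = subbox X 0 ratio 0 (1 - ratio), b = subbox X ratio 1 0 ratio,
      c = subbox X (1 - ratio) 1 ratio 1, d = subbox X 0 (1 - ratio) (1 - ratio) 1 &
      e = subbox X ratio (1 - ratio) ratio (1 - ratio)].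
Proof.
move=> [W0 H0] [[[a1 a2] [b1 b2] [c1 c2] [d1 d2]] [s1 s2 s3 s4] [e1 e2 e3 e4] [l1 l2]].
rewrite /barea /subbox /bwidth /bheight.
set W := xhi X - xlo X; set H := yhi X - ylo X.
have {}W0 : 0 < W by rewrite /W; lra.
have {}H0 : 0 < H by rewrite /H; lra.
have [Wn Hn] : W != 0 /\ H != 0 by rewrite !gt_eqF.
pose xa := (xhi a - xlo X) / W; pose yb := (yhi b - ylo X) / H.
pose xd := (xhi d - xlo X) / W; pose ya := (yhi a - ylo X) / H.
have Exa : xhi a = xlo X + xa * W by rewrite /xa divfK //; ring.
have Exd : xhi d = xlo X + xd * W by rewrite /xd divfK //; ring.
have Eya : yhi a = ylo X + ya * H by rewrite /ya divfK //; ring.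
have Eyb : yhi b = ylo X + yb * H by rewrite /yb divfK //; ring.
have EX : xhi X = xlo X + W by rewrite /W; ring.
have EY : yhi X = ylo X + H by rewrite /H; ring.
rewrite a1 a2 b1 b2 c1 c2 d1 d2 s1 s2 s3 s4 Exa Exd Eya Eyb EX EY.
move=> [A1 A2 A3 A4].
have WH : W * H != 0 by rewrite mulf_neq0.
have ltba : yb < ya by move: l2; rewrite Eya Eyb ltrD2l ltr_pM2r.
have [|||||m ya' yb' xd' lt] := @pinwheel_unit R xa ya yb xd.
- by apply: (mulIf WH); rewrite -A1; ring.
- by apply: (mulIf WH); rewrite -A2; ring.
- by apply: (mulIf WH); rewrite -A3; ring.
- by apply: (mulIf WH); rewrite -A4; ring.
- by [].
have r := ratio_unique m lt; rewrite -r.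
move: Exa Exd Eya Eyb; rewrite ya' yb' xd' => Exa Exd Eya Eyb.
rewrite {}EX {}EY in b1 c1 c2 d2.
move: a1 a2 b1 b2 c1 c2 d1 d2 s1 s2 s3 s4 e1 e2 e3 e4 Exa Exd Eya Eyb.
clear -W H xa; clearbody W H xa.
case: a b c d e => ? ? ? ? [? ? ? ?] [? ? ? ?] [? ? ? ?] [? ? ? ?] /= *.
split; congr Box; lra.
Qed.
End Ratio.

(** * Tiles are parallel to the sides *)

Section SmallStep.
Variable R : realFieldType.

(** Finitely many affine functions [t |-> f.1 + t * f.2] keep the sign that
they have at 0, when nonzero, at some common small [t]. *)
Lemma small_step (s : seq (R * R)) (d : R) : 0 < d ->
  exists2 t, 0 < t < d & forall f, f \in s ->
    (0 < f.1 -> 0 < f.1 + t * f.2) /\ (f.1 < 0 -> f.1 + t * f.2 < 0).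
Proof.
move=> d0; suff [t0 t00 ht0] : exists2 t0, 0 < t0 & forall t, 0 < t < t0 ->
    forall f, f \in s -> (0 < f.1 -> 0 < f.1 + t * f.2) /\ (f.1 < 0 -> f.1 + t * f.2 < 0).
  have m0 : 0 < Num.min d t0 by rewrite lt_min d0.
  exists (Num.min d t0 / 2%:R).
    have : Num.min d t0 <= d by rewrite ge_min lexx.
    by lra.
  have : Num.min d t0 <= t0 by rewrite ge_min lexx orbT.
  by move=> ?; apply: ht0; lra.
elim: s => [|[f g] s [t1 t10 IH]]; first by exists 1 => //; lra.
pose t2 := if f == 0 then 1 else `|f| / (`|g| + 1).
have g1 : 0 < `|g| + 1 by rewrite ltr_wpDl.
have t20 : 0 < t2.
  by rewrite /t2; case: eqVneq => // f0; rewrite divr_gt0 // normr_gt0.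
exists (Num.min t1 t2); first by rewrite lt_min t10.
move=> t /andP[t0]; rewrite lt_min => /andP[tt1 tt2] h.
rewrite inE => /predU1P[->|]; last by apply: IH; rewrite t0.
have [f0|f0] := eqVneq f 0; first by rewrite f0 /= ltxx.
have : t * (`|g| + 1) < `|f| by move: tt2; rewrite /t2 (negPf f0) ltr_pdivlMr.
have := ler_norm (t * g); have := ler_norm (- (t * g)).
rewrite normrN normrM (gtr0_norm t0) mulrDr mulr1 /=.
move=> h1 h2 h3; split=> sf.
- by rewrite (gtr0_norm sf) in h3; lra.
- by rewrite (ltr0_norm sf) in h3; lra.
Qed.
End SmallStep.

Section Frames.
Variable R : realType.
Implicit Types (r q : rect R) (p z : R * R).
Local Open Scope classical_set_scope.

Lemma rcos_sqr q : rcos q ^+ 2 = 1 - rsin q ^+ 2.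
Proof. by rewrite -(rdir_unit q) addrK. Qed.

(** Coordinates in the frame of [r], and the inverse map. *)
Definition toframe r p := (xcoord r p, ycoord r p).
Definition fromframe r z :=
  ((rorig r).1 + rcos r * z.1 - rsin r * z.2,
   (rorig r).2 + rsin r * z.1 + rcos r * z.2).

Lemma toframeK r : cancel (toframe r) (fromframe r).
Proof.
move=> [x y]; have u := rcos_sqr r; rewrite /fromframe /toframe /xcoord /ycoord /=.
by congr pair; ring: u.
Qed.

Lemma fromframeK r : cancel (fromframe r) (toframe r).
Proof.
move=> [x y]; have u := rcos_sqr r; rewrite /fromframe /toframe /xcoord /ycoord /=.
by congr pair; ring: u.
Qed.

Lemma inframe_unit r q : (rcos r * rcos q + rsin r * rsin q) ^+ 2 +
  (rcos r * rsin q - rsin r * rcos q) ^+ 2 = 1.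
Proof. have u := rcos_sqr r; have v := rcos_sqr q; ring: u v. Qed.

(** The rectangle [q] as seen in the frame of [r]. *)
Definition inframe r q : rect R :=
  Rect (toframe r (rorig q)) (inframe_unit r q) (width_gt0 q) (height_gt0 q).

Lemma xcoord_inframe r q p : xcoord (inframe r q) (toframe r p) = xcoord q p.
Proof.
have u := rcos_sqr r.
by rewrite /inframe /toframe [LHS]/xcoord /= /xcoord /ycoord; ring: u.
Qed.

Lemma ycoord_inframe r q p : ycoord (inframe r q) (toframe r p) = ycoord q p.
Proof.
have u := rcos_sqr r.
by rewrite /inframe /toframe [LHS]/ycoord /= /xcoord /ycoord; ring: u.
Qed.

Lemma points_inframe r q : points q = toframe r @^-1` points (inframe r q).
Proof.
by apply/seteqP; split => p; rewrite /points /preimage /= xcoord_inframe ycoord_inframe.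
Qed.

Lemma interior_inframe r q :
  interior_points q = toframe r @^-1` interior_points (inframe r q).
Proof.
by apply/seteqP; split => p;
  rewrite /interior_points /preimage /= xcoord_inframe ycoord_inframe.
Qed.

Lemma common_side_inframe r q q' :
  common_side (inframe r q) (inframe r q') -> common_side q q'.
Proof.
have side q0 A : is_side (inframe r q0) A -> is_side q0 (toframe r @^-1` A).
  rewrite /is_side (points_inframe r q0) => -[]->;
    [apply: Or41|apply: Or42|apply: Or43|apply: Or44];
    by apply/seteqP; split=> p; rewrite /= ?xcoord_inframe ?ycoord_inframe.
by move=> [A [/side s /side s']]; exists (toframe r @^-1` A).
Qed.

(** Two descriptions of the same rectangle, by different choices of vertex. *)
Definition redescribes q q' := [/\ points q = points q',
  interior_points q = interior_points q', is_side q = is_side q' & congruent q q'].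

Lemma congruent_trans q1 q2 q3 :
  congruent q1 q2 -> congruent q2 q3 -> congruent q1 q3.
Proof.
by rewrite /congruent => -[[-> ->]|[-> ->]] [[-> ->]|[-> ->]]; tauto.
Qed.

Lemma quarter_unit q : (- rsin q) ^+ 2 + rcos q ^+ 2 = 1.
Proof. by rewrite sqrrN addrC rdir_unit. Qed.

(** The description of [q] from the next vertex. *)
Definition quarter q : rect R :=
  Rect ((rorig q).1 + width q * rcos q, (rorig q).2 + width q * rsin q)
    (quarter_unit q) (height_gt0 q) (width_gt0 q).

Lemma xcoord_quarter q p : xcoord (quarter q) p = ycoord q p.
Proof. by rewrite /xcoord /ycoord /=; ring. Qed.

Lemma ycoord_quarter q p : ycoord (quarter q) p = width q - xcoord q p.
Proof. have u := rcos_sqr q; by rewrite /xcoord /ycoord /=; ring: u. Qed.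

Lemma quarter_redescribes q : redescribes q (quarter q).
Proof.
have pts : points q = points (quarter q).
  by apply/seteqP; split=> p; rewrite /points /= xcoord_quarter ycoord_quarter; lra.
have int : interior_points q = interior_points (quarter q).
  by apply/seteqP; split=> p;
    rewrite /interior_points /= xcoord_quarter ycoord_quarter; lra.
split => //; last by right.
apply/funext => A; apply/propext; rewrite /is_side -pts.
have <- : [set p | ycoord q p = 0] = [set p | xcoord (quarter q) p = 0].
  by apply/seteqP; split=> p; rewrite /= xcoord_quarter.
have <- : [set p | ycoord q p = height q] = [set p | xcoord (quarter q) p = width (quarter q)].
  by apply/seteqP; split=> p; rewrite /= xcoord_quarter.
have <- : [set p | xcoord q p = width q] = [set p | ycoord (quarter q) p = 0].
  by apply/seteqP; split=> p; rewrite /= ycoord_quarter; lra.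
have <- : [set p | xcoord q p = 0] = [set p | ycoord (quarter q) p = height (quarter q)].
  by apply/seteqP; split=> p; rewrite /= ycoord_quarter; lra.
split=> -[]; [exact: Or44|exact: Or43|exact: Or41|exact: Or42
  |exact: Or43|exact: Or44|exact: Or42|exact: Or41].
Qed.

Lemma redescribes_trans q1 q2 q3 :
  redescribes q1 q2 -> redescribes q2 q3 -> redescribes q1 q3.
Proof.
move=> [p i s c] [p' i' s' c']; split; [by rewrite p|by rewrite i|by rewrite s|].
exact: congruent_trans c'.
Qed.

(** With this choice of vertex, [rorig] is the lowest vertex. *)
Lemma first_quadrant q : exists2 q', redescribes q q' & 0 < rcos q' /\ 0 <= rsin q'.
Proof.
have r1 := quarter_redescribes q.
have r2 := redescribes_trans r1 (quarter_redescribes _).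
have r3 := redescribes_trans r2 (quarter_redescribes _).
have u := rdir_unit q.
have [[c0 s0]|[c0 s0]|[c0 s0]|[c0 s0]] : [\/ 0 < rcos q /\ 0 <= rsin q,
    rcos q <= 0 /\ 0 < rsin q, rcos q < 0 /\ rsin q <= 0 |
    0 <= rcos q /\ rsin q < 0].
- have [c0|c0|c0] := ltrgtP (rcos q) 0; have [s0|s0|s0] := ltrgtP (rsin q) 0;
    try by [apply: Or41; lra|apply: Or42; lra|apply: Or43; lra|apply: Or44; lra].
  by move: u; rewrite c0 s0; lra.
- by exists q => //; split => //; left.
- by exists (quarter (quarter (quarter q))) => //=; lra.
- by exists (quarter (quarter q)) => //=; lra.
- by exists (quarter q) => //=; lra.
Qed.

Lemma xcoord_step q v (t e1 e2 : R) : xcoord q (v.1 + t * e1, v.2 + t * e2) =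
  xcoord q v + t * (rcos q * e1 + rsin q * e2).
Proof. by rewrite /xcoord /=; ring. Qed.

Lemma ycoord_step q v (t e1 e2 : R) : ycoord q (v.1 + t * e1, v.2 + t * e2) =
  ycoord q v + t * (- rsin q * e1 + rcos q * e2).
Proof. by rewrite /ycoord /=; ring. Qed.

Lemma coord_origin q : xcoord q (rorig q) = 0 /\ ycoord q (rorig q) = 0.
Proof. by rewrite /xcoord /ycoord !subrr !mulr0 addr0. Qed.

(** If the tiles cover a small segment issuing from [v], then one of them
contains both [v] and some point of the segment. *)
Lemma cover_step (I : finType) (q : I -> rect R) v e (d : R) : 0 < d ->
  (forall t, 0 < t < d -> exists j, points (q j) (v.1 + t * e.1, v.2 + t * e.2)) ->
  exists2 t, 0 < t < d & exists2 j, points (q j) v &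
    points (q j) (v.1 + t * e.1, v.2 + t * e.2).
Proof.
move=> d0 cov.
pose gx j := rcos (q j) * e.1 + rsin (q j) * e.2.
pose gy j := - rsin (q j) * e.1 + rcos (q j) * e.2.
pose s j := [:: (xcoord (q j) v, gx j); (width (q j) - xcoord (q j) v, - gx j);
  (ycoord (q j) v, gy j); (height (q j) - ycoord (q j) v, - gy j)].
have [t ht hs] := small_step (flatten [seq s j | j : I]) d0.
exists t => //; have [j pj] := cov t ht; exists j => //.
have {}hs f : f \in s j -> (0 < f.1 -> 0 < f.1 + t * f.2) /\ (f.1 < 0 -> f.1 + t * f.2 < 0).
  by move=> fs; apply/hs/flattenP; exists (s j) => //; apply: map_f; rewrite mem_enum.
move: pj; rewrite /points /= xcoord_step ycoord_step -/(gx j) -/(gy j).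
have := hs (xcoord (q j) v, gx j); have := hs (width (q j) - xcoord (q j) v, - gx j).
have := hs (ycoord (q j) v, gy j); have := hs (height (q j) - ycoord (q j) v, - gy j).
rewrite !inE !eqxx !orbT /=.
move=> /(_ isT)[_ h4] /(_ isT)[_ h3] /(_ isT)[_ h2] /(_ isT)[_ h1] [hx hy].
split.
- by case: (ltrP (xcoord (q j) v) 0) => [/h1|?]; 
    case: (ltrP (width (q j) - xcoord (q j) v) 0) => [/h2|?]; lra.
- by case: (ltrP (ycoord (q j) v) 0) => [/h3|?]; 
    case: (ltrP (height (q j) - ycoord (q j) v) 0) => [/h4|?]; lra.
Qed.

Lemma tiles_aligned (I : finType) (W H : R) (q : I -> rect R) :
  (forall i, 0 < rcos (q i) /\ 0 <= rsin (q i)) ->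
  (forall z, (exists i, points (q i) z) <-> 0 <= z.1 <= W /\ 0 <= z.2 <= H) ->
  (forall i j, i != j -> interior_points (q i) `&` interior_points (q j) = set0) ->
  forall i, rsin (q i) = 0.
Proof.
move=> quad cov disj i0; apply/eqP/contraT => ni0.
have si0 : 0 < rsin (q i0) by rewrite lt_neqAle eq_sym ni0; case: (quad i0).
case: (Order.TotalTheory.arg_minP (P := fun i => 0 < rsin (q i))
  (fun i => (rorig (q i)).2) si0) => N sN minN {i0 ni0 si0}.
have common i j z : i != j -> interior_points (q i) z -> interior_points (q j) z -> False.
  by move=> /disj ij zi zj; have : set0 z by rewrite -ij.
set v := rorig (q N); set c := rcos (q N); set s := rsin (q N).
have [c0 _] := quad N; rewrite -/c in c0.
have [w0 h0] := (width_gt0 (q N), height_gt0 (q N)).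
have [xv yv] := coord_origin (q N); rewrite -/v in xv yv.
have unitN := rdir_unit (q N); rewrite -/c -/s in unitN sN.
(* A direction in the open first quadrant, to the right of the side (c, s) of
   the tile N. *)
pose e := (2%:R * c, s).
have inN z : points (q N) z -> 0 <= z.1 <= W /\ 0 <= z.2 <= H.
  by move=> zN; apply/cov; exists N.
have vbox : 0 <= v.1 <= W /\ 0 <= v.2 <= H.
  by apply: inN; rewrite /points /= xv yv; lra.
have ubox : 0 <= v.1 + width (q N) * c <= W /\ 0 <= v.2 + width (q N) * s <= H.
  apply: (inN (v.1 + _ * c, v.2 + _ * s)).
  rewrite /points /= xcoord_step ycoord_step xv yv /= -/c -/s.
  have -> : c * c + s * s = 1 by rewrite -unitN; ring.
  have -> : - s * c + c * s = 0 by ring.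
  by lra.
have d0 : 0 < width (q N) / 2%:R by lra.
have [|t ht [j jv jp]] := @cover_step I q v e _ d0.
  move=> t ht; apply/cov; rewrite /e /=; nra.
have jN : j != N.
  apply/eqP => jN; move: jp; rewrite jN /points /= => -[_].
  rewrite ycoord_step yv /= -/c -/s => /andP[jp _].
  have : 0 < t * (c * s) by rewrite !mulr_gt0 //; lra.
  by lra.
have [cj sj] := quad j; have [wj hj] := (width_gt0 (q j), height_gt0 (q j)).
move: sj; rewrite le_eqVlt => /predU1P[sj|sj].
- have cj1 : rcos (q j) = 1 by have := rdir_unit (q j); rewrite -sj; nra.
  (* A direction of the open first quadrant that enters N: the side (c, s)
     turned slightly towards the side (- s, c). *)
  pose f := (c - c * s / 2%:R, s + c ^+ 2 / 2%:R).
  have uf : c * f.1 + s * f.2 = 1 by rewrite -unitN /f /=; field.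
  have nf : - s * f.1 + c * f.2 = c / 2%:R.
    by transitivity (c / 2%:R * (c ^+ 2 + s ^+ 2));
      [rewrite /f /=; field | rewrite unitN mulr1].
  have [f1 f2] : 0 < f.1 /\ 0 < f.2 by rewrite /f /=; nra.
  clearbody f.
  have [t' ht' hs] := small_step [:: (width (q N), -1); (height (q N), - (c / 2%:R));
    (width (q j) - xcoord (q j) v, - f.1); (height (q j) - ycoord (q j) v, - f.2)] ltr01.
  have [h1 _] := hs (width (q N), -1) ltac:(by rewrite !inE eqxx ?orbT).
  have [h2 _] := hs (height (q N), - (c / 2%:R)) ltac:(by rewrite !inE eqxx ?orbT).
  have [h3 _] := hs (width (q j) - xcoord (q j) v, - f.1) ltac:(by rewrite !inE eqxx ?orbT).
  have [h4 _] := hs (height (q j) - ycoord (q j) v, - f.2) ltac:(by rewrite !inE eqxx ?orbT).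
  exfalso; apply: (common _ _ (v.1 + t' * f.1, v.2 + t' * f.2) jN).
  + move: jv jp; rewrite /points /interior_points /= !xcoord_step !ycoord_step.
    rewrite /= -sj cj1 /= in h3 h4 *.
    have pc : 0 < t * c by rewrite mulr_gt0 //; lra.
    have ps : 0 < t * s by rewrite mulr_gt0 //; lra.
    have pf1 : 0 < t' * f.1 by rewrite mulr_gt0 //; lra.
    have pf2 : 0 < t' * f.2 by rewrite mulr_gt0 //; lra.
    by move=> ? ?; split; [move: h3|move: h4]; lra.
  + rewrite /interior_points /= xcoord_step ycoord_step xv yv uf nf /=.
    rewrite /= in h1 h2; have {}h1 := h1 w0; have {}h2 := h2 h0.
    have pc : 0 < t' * c by rewrite mulr_gt0 //; lra.
    by lra.
- (* The lowest vertex of the tile j is v, and the upward direction enters both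
     tiles. *)
  have oj := minN j sj; rewrite -/v in oj.
  have := jv; rewrite /points /= => -[/andP[x0 _] /andP[y0 _]].
  have e2 : v.2 - (rorig (q j)).2 =
      rsin (q j) * xcoord (q j) v + rcos (q j) * ycoord (q j) v.
    by have u := rcos_sqr (q j); rewrite /xcoord /ycoord; ring: u.
  have x00 : xcoord (q j) v = 0 by nra.
  have y00 : ycoord (q j) v = 0 by nra.
  have [t' ht' hs] := small_step [:: (width (q N), -s); (height (q N), - c);
    (width (q j), - rsin (q j)); (height (q j), - rcos (q j))] ltr01.
  have [h1 _] := hs (width (q N), - s) ltac:(by rewrite !inE eqxx ?orbT).
  have [h2 _] := hs (height (q N), - c) ltac:(by rewrite !inE eqxx ?orbT).
  have [h3 _] := hs (width (q j), - rsin (q j)) ltac:(by rewrite !inE eqxx ?orbT).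
  have [h4 _] := hs (height (q j), - rcos (q j)) ltac:(by rewrite !inE eqxx ?orbT).
  exfalso; apply: (common _ _ (v.1 + t' * 0, v.2 + t' * 1) jN).
  + rewrite /interior_points /= xcoord_step ycoord_step x00 y00 /=.
    rewrite /= in h3 h4; have {}h3 := h3 wj; have {}h4 := h4 hj.
    have pc : 0 < t' * rcos (q j) by rewrite mulr_gt0 //; lra.
    have ps : 0 < t' * rsin (q j) by rewrite mulr_gt0 //; lra.
    by lra.
  + rewrite /interior_points /= xcoord_step ycoord_step xv yv /= -/c -/s.
    rewrite /= in h1 h2; have {}h1 := h1 w0; have {}h2 := h2 h0.
    have pc : 0 < t' * c by rewrite mulr_gt0 //; lra.
    have ps : 0 < t' * s by rewrite mulr_gt0 //; lra.
    by lra.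
Qed.
End Frames.

(** * From partitions to tilings by boxes *)

Section Assembly.
Variable R : realType.
Implicit Types (r q : rect R) (X Y : box R).
Local Open Scope classical_set_scope.

Definition boxset X : set (R * R) :=
  [set z | xlo X <= z.1 <= xhi X /\ ylo X <= z.2 <= yhi X].

(** The rectangle [r] in its own frame. *)
Definition framebox r := Box 0 (width r) 0 (height r).

Lemma points_framebox r : points r = toframe r @^-1` boxset (framebox r).
Proof. by []. Qed.

Lemma framebox_solid r : solid (framebox r).
Proof. by split=> /=; [exact: width_gt0|exact: height_gt0]. Qed.

Lemma overlap_point X Y : solid X -> solid Y -> ~ apart X Y ->
  exists x y, [/\ xlo X < x < xhi X, ylo X < y < yhi X,
                  xlo Y < x < xhi Y & ylo Y < y < yhi Y].
Proof.
have between (a b c d : R) : a < b -> c < d -> a < d -> c < b ->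
    exists x, a < x < b /\ c < x < d.
  move=> ab cd ad cb; exists ((Num.max a c + Num.min b d) / 2%:R).
  have [m1 m2] : a <= Num.max a c /\ c <= Num.max a c by rewrite !le_max !lexx orbT.
  have [n1 n2] : Num.min b d <= b /\ Num.min b d <= d by rewrite !ge_min !lexx orbT.
  have : Num.max a c < Num.min b d by rewrite gt_max !lt_min ab cd ad cb.
  by lra.
move=> [x1 y1] [x2 y2] nap.
have [xYX xXY yYX yXY] : [/\ xlo X < xhi Y, xlo Y < xhi X, ylo X < yhi Y & ylo Y < yhi X].
  by split; rewrite ltNge; apply: contra_notN nap; rewrite /apart; tauto.
have [x [? ?]] := between _ _ _ _ x1 x2 xYX xXY.
have [y [? ?]] := between _ _ _ _ y1 y2 yYX yXY.
by exists x, y.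
Qed.

(** The box occupied by a rectangle of direction (1, 0). *)
Definition rectbox q := Box (rorig q).1 ((rorig q).1 + width q)
  (rorig q).2 ((rorig q).2 + height q).

Lemma upright_coord q z : rcos q = 1 -> rsin q = 0 ->
  xcoord q z = z.1 - (rorig q).1 /\ ycoord q z = z.2 - (rorig q).2.
Proof.
by move=> c1 s0; rewrite /xcoord /ycoord c1 s0 oppr0 !mul1r !mul0r addr0 add0r.
Qed.

Lemma upright_points q : rcos q = 1 -> rsin q = 0 -> points q = boxset (rectbox q).
Proof.
move=> c1 s0; apply/seteqP; split=> z; rewrite /points /boxset /=;
  have [-> ->] := upright_coord z c1 s0; lra.
Qed.

Lemma upright_interior q z : rcos q = 1 -> rsin q = 0 ->
  (xlo (rectbox q) < z.1 < xhi (rectbox q)) ->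
  (ylo (rectbox q) < z.2 < yhi (rectbox q)) -> interior_points q z.
Proof.
by move=> c1 s0; rewrite /interior_points /=; have [-> ->] := upright_coord z c1 s0; lra.
Qed.

Lemma upright_adjacent q q' : rcos q = 1 -> rsin q = 0 -> rcos q' = 1 -> rsin q' = 0 ->
  adjacent (rectbox q) (rectbox q') -> common_side q q'.
Proof.
move=> c1 s0 c1' s0'.
have co z := upright_coord z c1 s0; have co' z := upright_coord z c1' s0'.
have [w0 h0] := (width_gt0 q, height_gt0 q).
have [w0' h0'] := (width_gt0 q', height_gt0 q').
rewrite /adjacent /= => -[[[e1 e2] [e|e]]|[[e1 e2] [e|e]]].
- exists (points q `&` [set p | xcoord q p = width q]); split; first exact: Or42.
  apply: Or41; apply/seteqP; split=> z; rewrite /points /=;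
    have [-> ->] := co z; have [-> ->] := co' z; move=> -[[? ?] ?]; lra.
- exists (points q `&` [set p | xcoord q p = 0]); split; first exact: Or41.
  apply: Or42; apply/seteqP; split=> z; rewrite /points /=;
    have [-> ->] := co z; have [-> ->] := co' z; move=> -[[? ?] ?]; lra.
- exists (points q `&` [set p | ycoord q p = height q]); split; first exact: Or44.
  apply: Or43; apply/seteqP; split=> z; rewrite /points /=;
    have [-> ->] := co z; have [-> ->] := co' z; move=> -[[? ?] ?]; lra.
- exists (points q `&` [set p | ycoord q p = 0]); split; first exact: Or43.
  apply: Or44; apply/seteqP; split=> z; rewrite /points /=;
    have [-> ->] := co z; have [-> ->] := co' z; move=> -[[? ?] ?]; lra.
Qed.

(** Same dimensions up to order, as the two sides of a rectangle are not
distinguished by its points. *)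
Definition samedims q X :=
  (width q = bwidth X /\ height q = bheight X) \/
  (width q = bheight X /\ height q = bwidth X).

Lemma partition_boxes k r (Q : 'I_k -> rect R) : is_partition r Q ->
  exists T : 'I_k -> box R, [/\ tiling [set: 'I_k]%SET (framebox r) T,
    forall i, points (Q i) = toframe r @^-1` boxset (T i),
    forall i, samedims (Q i) (T i) &
    forall i j, adjacent (T i) (T j) -> common_side (Q i) (Q j)].
Proof.
move=> [covQ disjQ].
have /choice[q hq] : forall i, exists q', redescribes (inframe r (Q i)) q' /\
    (0 < rcos q' /\ 0 <= rsin q').
  by move=> i; have [q' ? ?] := first_quadrant (inframe r (Q i)); exists q'.
have ptsQ i : points (Q i) = toframe r @^-1` points (q i).
  by rewrite (points_inframe r (Q i)); case: (hq i) => -[->].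
have cov z : (exists i, points (q i) z) <-> 0 <= z.1 <= width r /\ 0 <= z.2 <= height r.
  rewrite -[z](fromframeK r); move: (fromframe r z) => p.
  have <- : points r p = (0 <= (toframe r p).1 <= width r /\
                          0 <= (toframe r p).2 <= height r) by [].
  rewrite -covQ; split=> [[i pi]|[i _ pi]]; exists i => //.
    by rewrite ptsQ.
  by rewrite ptsQ in pi.
have disj i j : i != j -> interior_points (q i) `&` interior_points (q j) = set0.
  move=> /disjQ; rewrite (interior_inframe r (Q i)) (interior_inframe r (Q j)).
  case: (hq i) (hq j) => -[_ -> _ _] _ [[_ -> _ _] _] dij.
  apply/seteqP; split=> // z [zi zj].
  have : set0 (fromframe r z) by rewrite -dij; split; rewrite /preimage /= fromframeK.
  by [].
have quad i : 0 < rcos (q i) /\ 0 <= rsin (q i) by case: (hq i).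
have s0 := tiles_aligned quad cov disj.
have c1 i : rcos (q i) = 1.
  by have := rdir_unit (q i); rewrite s0; case: (quad i); nra.
have sol i : solid (rectbox (q i)).
  by split; rewrite /= ltrDl; [exact: width_gt0|exact: height_gt0].
exists (fun i => rectbox (q i)); split.
- split=> //.
  + move=> i _; have [sx sy] := sol i; rewrite /= in sx sy.
    have inW z : points (q i) z -> 0 <= z.1 <= width r /\ 0 <= z.2 <= height r.
      by move=> zi; apply/cov; exists i.
    move: inW; rewrite upright_points // => inW.
    have := inW ((rorig (q i)).1, (rorig (q i)).2).
    have := inW ((rorig (q i)).1 + width (q i), (rorig (q i)).2 + height (q i)).
    rewrite /boxset /inside /= => h1 h2.
    have {}h1 := h1 ltac:(lra); have {}h2 := h2 ltac:(lra); lra.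
  + move=> i j _ _ ij; apply: contrapT; move=> nap.
    case: (overlap_point (sol i) (sol j) nap) =>
      [x [y [xi yi xj yj]]].
    have : (interior_points (q i) `&` interior_points (q j)) (x, y).
      by split; apply: upright_interior.
    by rewrite disj.
  + move=> x y /= hx hy.
    have [i] : exists i, points (q i) (x, y) by apply/cov => /=; lra.
    by rewrite upright_points // => -[? ?]; exists i; rewrite ?finset.in_setT.
- by move=> i; rewrite ptsQ upright_points.
- move=> i; case: (hq i) => -[_ _ _ cg] _; move: cg.
  by rewrite /congruent /samedims /bwidth /bheight /= ![_ + _ - _]addrAC !subrr !add0r.
- move=> i j /upright_adjacent; rewrite !s0 !c1 => /(_ erefl erefl erefl erefl) [A [si sj]].
  apply: (@common_side_inframe _ r).
  by exists A; case: (hq i) (hq j) => -[_ _ -> _] _ [[_ _ -> _] _].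
Qed.

End Assembly.

(** * The perfect pinwheel partition *)

Section Pinwheel5.
Variable R : realType.
Implicit Types (r q : rect R) (X Y : box R).
Local Open Scope classical_set_scope.

Local Notation rho := (ratio R).

Lemma toframe_preimage_inj r (B B' : set (R * R)) :
  toframe r @^-1` B = toframe r @^-1` B' -> B = B'.
Proof.
move=> e; apply/seteqP; split=> z; rewrite -[z](fromframeK r) => zB.
  by have : (toframe r @^-1` B) (fromframe r z) by []; rewrite e.
by have : (toframe r @^-1` B') (fromframe r z) by []; rewrite -e.
Qed.

Lemma boxset_inj X Y : xlo X <= xhi X -> ylo X <= yhi X ->
  xlo Y <= xhi Y -> ylo Y <= yhi Y -> boxset X = boxset Y -> X = Y.
Proof.
move=> x1 y1 x2 y2 e.
have h1 : boxset Y (xlo X, ylo X) by rewrite -e /boxset /=; lra.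
have h2 : boxset Y (xhi X, yhi X) by rewrite -e /boxset /=; lra.
have h3 : boxset X (xlo Y, ylo Y) by rewrite e /boxset /=; lra.
have h4 : boxset X (xhi Y, yhi Y) by rewrite e /boxset /=; lra.
move: x1 y1 x2 y2 h1 h2 h3 h4; clear; case: X Y => ? ? ? ? [? ? ? ?].
by rewrite /boxset /= => *; congr Box; lra.
Qed.

(** The rectangle occupying the box [X] of the frame of [r]. *)
Definition boxrect r X (s : solid X) : rect R :=
  Rect (fromframe r (xlo X, ylo X)) (rdir_unit r)
    (etrans (subr_gt0 _ _) (proj1 s)) (etrans (subr_gt0 _ _) (proj2 s)).

Lemma boxrect_coord r X (s : solid X) p :
  xcoord (boxrect r s) p = xcoord r p - xlo X /\
  ycoord (boxrect r s) p = ycoord r p - ylo X.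
Proof.
have u := rcos_sqr r.
by rewrite /xcoord /ycoord /fromframe /=; split; ring: u.
Qed.

Lemma boxrect_points r X (s : solid X) :
  points (boxrect r s) = toframe r @^-1` boxset X.
Proof.
apply/seteqP; split=> p; rewrite /points /boxset /preimage /=;
  have [-> ->] := boxrect_coord r s p; lra.
Qed.

Lemma boxrect_interior r X (s : solid X) p : interior_points (boxrect r s) p ->
  xlo X < xcoord r p < xhi X /\ ylo X < ycoord r p < yhi X.
Proof. by rewrite /interior_points /=; have [-> ->] := boxrect_coord r s p; lra. Qed.

(** A side is the set of points of a degenerate box. *)
Lemma boxrect_side r X (s : solid X) A : is_side (boxrect r s) A ->
  exists Y, [/\ A = toframe r @^-1` boxset Y, xlo Y <= xhi Y /\ ylo Y <= yhi Y &
    (xlo Y = xlo X /\ xhi Y = xhi X /\ ylo Y = yhi Y) \/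
    (ylo Y = ylo X /\ yhi Y = yhi X /\ xlo Y = xhi Y)].
Proof.
have [x0 y0] := s.
case=> ->.
- exists (Box (xlo X) (xlo X) (ylo X) (yhi X)); split => /=; [|lra|lra].
  apply/seteqP; split=> p; rewrite /points /boxset /preimage /=;
  have [-> ->] := boxrect_coord r s p; lra.
- exists (Box (xhi X) (xhi X) (ylo X) (yhi X)); split => /=; [|lra|lra].
  apply/seteqP; split=> p; rewrite /points /boxset /preimage /=;
  have [-> ->] := boxrect_coord r s p; lra.
- exists (Box (xlo X) (xhi X) (ylo X) (ylo X)); split => /=; [|lra|lra].
  apply/seteqP; split=> p; rewrite /points /boxset /preimage /=;
  have [-> ->] := boxrect_coord r s p; lra.
- exists (Box (xlo X) (xhi X) (yhi X) (yhi X)); split => /=; [|lra|lra].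
  apply/seteqP; split=> p; rewrite /points /boxset /preimage /=;
  have [-> ->] := boxrect_coord r s p; lra.
Qed.

(** A common side forces a common projection on one of the axes. *)
Lemma boxrect_common_side r X Y (s : solid X) (s' : solid Y) :
  common_side (boxrect r s) (boxrect r s') ->
  (xlo X = xlo Y /\ xhi X = xhi Y) \/ (ylo X = ylo Y /\ yhi X = yhi Y).
Proof.
move=> [A [/boxrect_side[Z [eZ [xZ yZ] hZ]] /boxrect_side[Z' [eZ' [xZ' yZ'] hZ']]]].
have [[x0 y0] [x0' y0']] := (s, s').
have e : Z = Z'.
  by apply: boxset_inj => //; apply: (@toframe_preimage_inj r); rewrite -eZ -eZ'.
by subst Z'; move: hZ hZ' x0 y0 x0' y0'; clear; lra.
Qed.

(** The tiles of the perfect pinwheel in [X]: the corner tiles, counterclockwise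
from the lower left one, and the central tile. *)
Definition pinbox X (i : 'I_5) : box R :=
  match val i with
  | 0%N => subbox X 0 rho 0 (1 - rho)
  | 1%N => subbox X rho 1 0 rho
  | 2%N => subbox X (1 - rho) 1 rho 1
  | 3%N => subbox X 0 (1 - rho) (1 - rho) 1
  | _ => subbox X rho (1 - rho) rho (1 - rho)
  end.

Lemma pinwheel_pinbox X T (A B C D E : 'I_5) : solid X ->
  pinwheel X (T A) (T B) (T C) (T D) (T E) ->
  (forall i, barea (T i) = 5%:R^-1 * barea X) ->
  forall j : 'I_5, T (nth A [:: A; B; C; D; E] j) = pinbox X j.
Proof.
move=> sX pin ar.
have [|hA hB hC hD hE] := pinwheel_perfect sX pin; first by split.
by move=> [[|[|[|[|[|]]]]] //= ?]; rewrite /pinbox.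
Qed.

Lemma ratio_scaled (W : R) : 0 < W ->
  0 < rho * W /\ rho * W < W - rho * W.
Proof.
move=> W0; have [_ /andP[r0 r1]] := ratioP R.
have := mulr_gt0 r0 W0; have : 0 < (1 - rho - rho) * W by rewrite mulr_gt0 //; lra.
by lra.
Qed.

Lemma pinbox_solid X i : solid X -> solid (pinbox X i).
Proof.
move=> [x0 y0]; have [] := @ratio_scaled (bwidth X); first by rewrite subr_gt0.
have [] := @ratio_scaled (bheight X); first by rewrite subr_gt0.
move: x0 y0; rewrite -subr_gt0 -/(bwidth X) -subr_gt0 -/(bheight X).
rewrite /pinbox; case: i => -[|[|[|[|[|]]]]] //= _; rewrite /solid /subbox /=; lra.
Qed.

Lemma pinbox_apart X i j : solid X -> i != j -> apart (pinbox X i) (pinbox X j).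
Proof.
move=> [x0 y0]; have [] := @ratio_scaled (bwidth X); first by rewrite subr_gt0.
have [] := @ratio_scaled (bheight X); first by rewrite subr_gt0.
rewrite /pinbox; case: i j => -[|[|[|[|[|]]]]] //= ? [[|[|[|[|[|]]]]] //= ?] h1 h2 h3 h4 // _;
  rewrite /apart /subbox /=; lra.
Qed.

Lemma pinbox_unaligned X i j : solid X -> i != j ->
  ~ ((xlo (pinbox X i) = xlo (pinbox X j) /\ xhi (pinbox X i) = xhi (pinbox X j)) \/
     (ylo (pinbox X i) = ylo (pinbox X j) /\ yhi (pinbox X i) = yhi (pinbox X j))).
Proof.
move=> [x0 y0]; have [] := @ratio_scaled (bwidth X); first by rewrite subr_gt0.
have [] := @ratio_scaled (bheight X); first by rewrite subr_gt0.
rewrite /pinbox; case: i j => -[|[|[|[|[|]]]]] //= ? [[|[|[|[|[|]]]]] //= ?] h1 h2 h3 h4 // _;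
  rewrite /subbox /=; lra.
Qed.

Lemma pinbox_cover X : solid X -> \bigcup_i boxset (pinbox X i) = boxset X.
Proof.
move=> [x0 y0]; have [] := @ratio_scaled (bwidth X); first by rewrite subr_gt0.
have [] := @ratio_scaled (bheight X); first by rewrite subr_gt0.
have EX : xhi X = xlo X + bwidth X by rewrite /bwidth; ring.
have EY : yhi X = ylo X + bheight X by rewrite /bheight; ring.
move=> h1 h2 h3 h4; apply/seteqP; split=> [z [i _]|z].
  rewrite /pinbox /boxset; case: i => -[|[|[|[|[|]]]]] //= _; lra.
rewrite /boxset /= => hz.
have [hA|hA] := boolP ((z.1 <= xlo X + rho * bwidth X) &&
                       (z.2 <= yhi X - rho * bheight X)).
  by exists (@Ordinal 5 0 isT) => //=; rewrite /pinbox /=; lra.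
have [hB|hB] := boolP ((xlo X + rho * bwidth X <= z.1) &&
                       (z.2 <= ylo X + rho * bheight X)).
  by exists (@Ordinal 5 1 isT) => //=; rewrite /pinbox /=; lra.
have [hC|hC] := boolP ((xhi X - rho * bwidth X <= z.1) &&
                       (ylo X + rho * bheight X <= z.2)).
  by exists (@Ordinal 5 2 isT) => //=; rewrite /pinbox /=; lra.
have [hD|hD] := boolP ((z.1 <= xhi X - rho * bwidth X) &&
                       (yhi X - rho * bheight X <= z.2)).
  by exists (@Ordinal 5 3 isT) => //=; rewrite /pinbox /=; lra.
exists (@Ordinal 5 4 isT) => //=; rewrite /pinbox /=; lra.
Qed.

Lemma pinbox_area X i : barea (pinbox X i) = 5%:R^-1 * barea X.
Proof.
have [m _] := ratioP R.
rewrite /pinbox; case: i => -[|[|[|[|[|]]]]] //= _;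
  rewrite -m /barea /subbox /bwidth /bheight /=; try ring.
transitivity ((1 - 4%:R * (rho * (1 - rho))) * ((xhi X - xlo X) * (yhi X - ylo X))).
  by ring.
by rewrite m; field.
Qed.

(** The perfect pinwheel partition of [r]. *)
Definition pinrect r i : rect R := boxrect r (pinbox_solid i (framebox_solid r)).

Lemma pinrect_partition r : is_partition r (pinrect r).
Proof.
split.
  rewrite points_framebox -(pinbox_cover (framebox_solid r)) preimage_bigcup.
  by apply: eq_bigcup => // i _; exact: boxrect_points.
move=> i j /(pinbox_apart (framebox_solid r)) ap; apply/seteqP; split=> // p [].
by move=> /boxrect_interior pi /boxrect_interior pj; move: ap; rewrite /apart; lra.
Qed.

Lemma pinrect_admissible r : admissible (pinrect r).
Proof.
move=> i j ij /boxrect_common_side.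
exact: (pinbox_unaligned (framebox_solid r) ij).
Qed.

Lemma pinrect_perfect r : perfect r (pinrect r).
Proof.
move=> i; have := pinbox_area (framebox r) i.
by rewrite /area {2}/barea /bwidth /bheight /= !subr0.
Qed.

(** Reflection of [r] exchanging its sides [xcoord = 0] and [xcoord = width],
acting on boxes of its frame and on points. *)
Definition mirror r X := Box (width r - xhi X) (width r - xlo X) (ylo X) (yhi X).

Definition reflect r p := fromframe r (width r - xcoord r p, ycoord r p).

Lemma reflect_box r X :
  reflect r @` (toframe r @^-1` boxset X) = toframe r @^-1` boxset (mirror r X).
Proof.
have tr p : toframe r (reflect r p) = (width r - xcoord r p, ycoord r p).
  exact: fromframeK.
apply/seteqP; split=> [_ [p pX <-]|p pX].
  by move: pX; rewrite /preimage /= tr /boxset /=; lra.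
have [e1 e2] : width r - xcoord r (reflect r p) = xcoord r p /\
    ycoord r (reflect r p) = ycoord r p.
  by case: (tr p) => -> ->; split => //; ring.
exists (reflect r p).
  by move: pX; rewrite /preimage /= tr /boxset /=; lra.
by rewrite {1}/reflect e1 e2; exact: toframeK.
Qed.

Lemma edist_frame r (p z : R * R) : edist p z =
  Num.sqrt ((xcoord r p - xcoord r z) ^+ 2 + (ycoord r p - ycoord r z) ^+ 2).
Proof.
have u := rcos_sqr r.
by rewrite /edist /xcoord /ycoord; congr Num.sqrt; ring: u.
Qed.

Lemma reflect_symmetry r : is_symmetry r (reflect r).
Proof.
split=> [p q|].
  have tr p' : toframe r (reflect r p') = (width r - xcoord r p', ycoord r p').
    exact: fromframeK.
  rewrite !(edist_frame r); case: (tr p) (tr q) => -> -> [-> ->].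
  by congr Num.sqrt; ring.
rewrite points_framebox reflect_box; congr (_ @^-1` boxset _).
by rewrite /mirror /framebox /= subr0 subrr.
Qed.

(** A tiling by five nonadjacent tiles of equal areas is, up to the numbering [s]
of the tiles, the perfect pinwheel or its mirror image. *)
Lemma perfect_tiling r (T : 'I_5 -> box R) :
  tiling [set: 'I_5]%SET (framebox r) T ->
  (forall i j, i != j -> ~ adjacent (T i) (T j)) ->
  (forall i, barea (T i) = 5%:R^-1 * (width r * height r)) ->
  exists2 s : 'I_5 -> 'I_5, injective s &
    (forall j, T (s j) = pinbox (framebox r) j) \/
    (forall j, T (s j) = mirror r (pinbox (framebox r) j)).
Proof.
move=> tl nadj ar.
have [||A [B [C [D [E cf]]]]] := tiling_config tl.
- by rewrite cardsT card_ord.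
- by move=> i j _ _; exact: nadj.
have inj x (s : seq 'I_5) : uniq s -> size s = 5 ->
    injective (fun j : 'I_5 => nth x s j).
  by move=> us s5 i j /eqP; rewrite nth_uniq ?s5 // => /eqP/val_inj.
have sX := framebox_solid r.
have aX : barea (framebox r) = width r * height r.
  by rewrite /barea /bwidth /bheight /= !subr0.
have [pin|pin] := config_pinwheel cf.
  exists (fun j => nth A [:: A; B; C; D; E] j); first exact: (inj _ _ (cfg_uniq cf) erefl).
  by left; apply: pinwheel_pinbox => //; rewrite aX.
exists (fun j => nth B [:: B; A; D; C; E] j).
  exact: (inj _ _ (cfg_uniq (config_flipx cf)) erefl).
right=> j; have ff Y : flipx (flipx Y) = Y by case: Y => *; rewrite /flipx /= !opprK.
have {}pin : (@flipx R \o T) (nth B [:: B; A; D; C; E] j) = pinbox (flipx (framebox r)) j.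
  apply: pinwheel_pinbox => //; first by move: sX; rewrite /solid /=; lra.
  move=> i; rewrite /barea /bwidth /bheight /=.
  by have := ar i; rewrite /barea /bwidth /bheight; lra.
rewrite -[LHS]ff [flipx (T _)]pin.
rewrite /mirror /pinbox; case: (val j) => [|[|[|[|?]]]];
  rewrite /flipx /subbox /bwidth /bheight /=; congr Box; ring.
Qed.

Lemma tiles_of_boxes r (Q : 'I_5 -> rect R) (T U : 'I_5 -> box R) (s : 'I_5 -> 'I_5) :
  injective s -> (forall i, points (Q i) = toframe r @^-1` boxset (T i)) ->
  (forall j, T (s j) = U j) ->
  tiles Q = [set toframe r @^-1` boxset (U j) | j in [set: 'I_5]].
Proof.
move=> sinj ptsQ TU; apply/seteqP; split=> [_ [i _ <-]|_ [j _ <-]].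
  have [s' _ sK] := injF_bij sinj.
  by exists (s' i) => //; rewrite ptsQ -TU sK.
by exists (s j) => //; rewrite ptsQ TU.
Qed.

Lemma samedims_area q X : samedims q X -> area q = barea X.
Proof. by rewrite /area /barea => -[[-> ->]|[-> ->]] //; rewrite mulrC. Qed.

Lemma samedims_congruent q q' X X' : samedims q X -> samedims q' X' ->
  bwidth X = bwidth X' -> bheight X = bheight X' -> congruent q q'.
Proof.
by rewrite /congruent => -[[-> ->]|[-> ->]] [[-> ->]|[-> ->]] -> ->; tauto.
Qed.

Lemma adjacent_dims X Y : solid X -> solid Y -> barea X = barea Y -> adjacent X Y ->
  bwidth X = bwidth Y /\ bheight X = bheight Y.
Proof.
move=> [x0 y0] [x0' y0'] ar [[[e1 e2] _]|[[e1 e2] _]].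
  have eh : bheight X = bheight Y by rewrite /bheight e1 e2.
  split=> //; apply: (@mulIf _ (bheight X)); first by rewrite gt_eqF // subr_gt0.
  by rewrite {2}eh.
have ew : bwidth X = bwidth Y by rewrite /bwidth e1 e2.
split=> //; apply: (@mulfI _ (bwidth X)); first by rewrite gt_eqF // subr_gt0.
by rewrite {2}ew.
Qed.

End Pinwheel5.

(** * Perfect partitions into five rectangles *)

Theorem proposition2p1 (R : realType) (r : rect R) :
  (~ exists P : 'I_5 -> rect R,
       is_partition r P /\ mondrian P /\ perfect r P) /\
  (exists P : 'I_5 -> rect R,
     (is_partition r P /\ admissible P /\ perfect r P) /\
     forall Q : 'I_5 -> rect R,
       is_partition r Q -> admissible Q -> perfect r Q ->
       same_up_to_symmetry r P Q).
Proof.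
split.
  move=> [P [part [mond perf]]].
  have [T [tl pts dims _]] := partition_boxes part.
  have ar i : barea (T i) = 5%:R^-1 * (width r * height r).
    by rewrite -(samedims_area (dims i)) perf.
  have sol i : solid (T i) by apply: (tile_solid tl); rewrite finset.in_setT.
  have cong i j : i != j -> bwidth (T i) = bwidth (T j) ->
      bheight (T i) = bheight (T j) -> False.
    by move=> ij ew eh; apply: (mond i j ij); apply: samedims_congruent ew eh.
  have nadj i j : i != j -> ~ adjacent (T i) (T j).
    move=> ij adj; have eqar : barea (T i) = barea (T j) by rewrite !ar.
    by have [ew eh] := adjacent_dims (sol i) (sol j) eqar adj; exact: cong ew eh.
  have [s sinj pin] := perfect_tiling tl nadj ar.
  (* Two opposite corner tiles. *)
  pose i0 := @Ordinal 5 0 isT; pose i2 := @Ordinal 5 2 isT.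
  apply: (cong (s i0) (s i2)); first by rewrite (inj_eq sinj).
    by case: pin => pin; rewrite !pin /mirror /bwidth /=; ring.
  by case: pin => pin; rewrite !pin /mirror /bheight /=; ring.
exists (pinrect r); split.
  split; [exact: pinrect_partition|split].
    exact: pinrect_admissible.
  exact: pinrect_perfect.
move=> Q part adm perf.
have [T [tl pts dims cs]] := partition_boxes part.
have ar i : barea (T i) = 5%:R^-1 * (width r * height r).
  by rewrite -(samedims_area (dims i)) perf.
have nadj i j : i != j -> ~ adjacent (T i) (T j).
  by move=> /adm nc /cs.
have [s sinj pin] := perfect_tiling tl nadj ar.
have tP : tiles (pinrect r) =
    [set toframe r @^-1` boxset (pinbox (framebox r) j) | j in [set: 'I_5]]%classic.
  by apply: (tiles_of_boxes (s := id) (T := pinbox (framebox r))) => // i;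
    exact: boxrect_points.
case: pin => pin.
  exists id; split; first by split=> //; exact: image_id.
  rewrite (tiles_of_boxes sinj pts pin) -tP -[RHS]image_id.
  by apply: eq_imagel => A _; exact: image_id.
exists (reflect r); split; first exact: reflect_symmetry.
rewrite tP (tiles_of_boxes sinj pts pin) image_comp.
by apply: eq_imagel => j _ /=; exact: reflect_box.
Qed.
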